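(* Let $k\ge 1$ be an integer and let $a_0\in\mathbb{C}$ satisfy $a_0^{2k}=(-1)^k$ and $a_0\neq \pm i$. Then for every oriented link $L$ and every link $\bar t_{2k}(L)$ obtained from $L$ by a $\bar t_{2k}$ move, $$P_{\bar t_{2k}(L)}(a_0,z)=P_L(a_0,z).$$
   Context: The Jones-Conway (Homfly) polynomial $P_L(a,z)\in\mathbb{Z}[a^{\pm1},z^{\pm1}]$ is the invariant of oriented links in $S^3$ determined by (i) $P_{T_1}(a,z)=1$ for the trivial knot $T_1$, and (ii) $aP_{L_+}(a,z)+a^{-1}P_{L_-}(a,z)=zP_{L_0}(a,z)$, where $L_+,L_-,L_0$ are oriented diagrams identical except near one point, where they have respectively a positive crossing, a negative crossing, and the oriented smoothing. A $\bar t_{2k}$ move: let $L$ be an oriented diagram which in some disk consists of two parallel strands without crossings, oriented in opposite directions (antiparallel). The diagram $\bar t_{2k}(L)$ is obtained by replacing these strands by $2k$ half twists of the two strands around each other, of the handedness for which the crossings would be positive if the two strands were oriented in the same direction; $\bar t_{2k}(L)$ inherits the orientation of $L$, and with this orientation the $2k$ new crossings are negative. *)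

(* Defs.v *)
From HB Require Import structures.
From Stdlib Require Import Relation_Operators.
From mathcomp Require Import all_boot all_order all_algebra generic_quotient.
From mathcomp Require Import finmap monalg.
From mathcomp Require Import boolp reals complex.

Set Implicit Arguments.
Unset Strict Implicit.
Unset Printing Implicit Defensive.

Import GRing.Theory.
Local Open Scope ring_scope.

(* [grpalg R K] is the group ring R[K] of an additive abelian group K; the     *)
(* element <<c *g k>> of monalg is the monomial c X^k.  The library only has a *)
(* ring structure on {malg R[K]} for monoids K in which 0 is the only unit.    *)
(* Laurent polynomials in one variable over R are [grpalg R int], in two       *)
(* variables [grpalg R (int * int)].                                           *)
Definition grpalg (R : comNzRingType) (K : zmodType) : Type := {malg R[K]}.

HB.instance Definition _ (R : comNzRingType) (K : zmodType) :=
  GRing.Zmodule.copy (grpalg R K) {malg R[K]}.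

Section GrpalgRing.
Context (R : comNzRingType) (K : zmodType).
Local Open Scope fset_scope.
Local Open Scope ring_scope.
Implicit Types (g : {malg R[K]}) (k : K).

Definition gaone : {malg R[K]} := << 1 *g 0%R >>.

Definition gamul g1 g2 : {malg R[K]} :=
  \sum_(k1 <- msupp g1) \sum_(k2 <- msupp g2) << g1@_k1 * g2@_k2 *g k1 + k2 >>.

Lemma gamulC : commutative gamul.
Proof.
move=> g1 g2; rewrite /gamul exchange_big /=.
by apply/eq_bigr=> k2 _; apply/eq_bigr=> k1 _; rewrite mulrC addrC.
Qed.

Lemma gamulw (d1 d2 : {fset K}) g1 g2 :
  msupp g1 `<=` d1 -> msupp g2 `<=` d2 ->
  gamul g1 g2 =
    \sum_(k1 <- d1) \sum_(k2 <- d2) << g1@_k1 * g2@_k2 *g k1 + k2 >>.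
Proof.
move=> le_d1 le_d2; rewrite /gamul (big_fset_incl _ le_d1) /=.
  apply/eq_bigr=> k1 _; apply/big_fset_incl => // k _ /mcoeff_outdom ->.
  by rewrite mulr0 monalgU0.
move=> k _ /mcoeff_outdom g1k.
by rewrite big1 => // k' _; rewrite g1k mul0r monalgU0.
Qed.

Lemma gamul0g : left_zero 0 gamul.
Proof. by move=> g; rewrite /gamul msupp0 big_seq_fset0. Qed.

Lemma gamulUg c k g :
  gamul << c *g k >> g = \sum_(k' <- msupp g) << c * g@_k' *g k + k' >>.
Proof.
rewrite (gamulw msuppU_le (fsubset_refl _)) big_seq_fset1.
by apply/eq_bigr => k' _; rewrite mcoeffUU.
Qed.

Lemma gamulUU c1 c2 k1 k2 :
  gamul << c1 *g k1 >> << c2 *g k2 >> = << c1 * c2 *g k1 + k2 >>.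
Proof. by rewrite (gamulw msuppU_le msuppU_le) !big_seq_fset1 !mcoeffUU. Qed.

Lemma gamul1g : left_id gaone gamul.
Proof.
move=> g; rewrite gamulUg [RHS]monalgE.
by apply/eq_bigr=> kg _; rewrite mul1r add0r.
Qed.

Lemma gamulDl : left_distributive gamul +%R.
Proof.
move=> g1 g2 g.
rewrite (gamulw (msuppD_le _ _) (fsubset_refl (msupp g))).
rewrite (gamulw (fsubsetUl _ (msupp g2)) (fsubset_refl (msupp g))).
rewrite (gamulw (fsubsetUr (msupp g1) _) (fsubset_refl (msupp g))).
rewrite -big_split /=; apply/eq_bigr=> k1 _.
rewrite -big_split /=; apply/eq_bigr=> k2 _.
by rewrite mcoeffD mulrDl monalgUD.
Qed.

Lemma gamulE g1 g2 :
  gamul g1 g2 = \sum_(k1 <- msupp g1) gamul << g1@_k1 *g k1 >> g2.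
Proof. by apply/eq_bigr=> k _; rewrite gamulUg. Qed.

Lemma gamulA : associative gamul.
Proof.
have sumL I (r : seq I) F g :
    gamul (\sum_(i <- r) F i) g = \sum_(i <- r) gamul (F i) g.
  exact: (big_morph (gamul^~ g) (fun x y => gamulDl x y g) (gamul0g g)).
have sumR I (r : seq I) F g :
    gamul g (\sum_(i <- r) F i) = \sum_(i <- r) gamul g (F i).
  by rewrite gamulC sumL; apply/eq_bigr=> i _; rewrite gamulC.
move: gamulUU sumL sumR; move: gamul => m mUU sumL sumR g1 g2 g3.
rewrite (monalgE g1) !sumL; apply/eq_bigr=> k1 _.
rewrite (monalgE g2) sumR !sumL sumR; apply/eq_bigr=> k2 _.
rewrite (monalgE g3) !sumR; apply/eq_bigr=> k3 _.
by rewrite !mUU mulrA addrA.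
Qed.

Lemma gaone_neq0 : gaone != 0.
Proof. by rewrite monalgU_eq0 oner_eq0. Qed.

HB.instance Definition _ := GRing.Zmodule_isComNzRing.Build (grpalg R K)
  gamulA gamulC gamul1g gamulDl gaone_neq0.

End GrpalgRing.

Definition laurent_az := grpalg int (int * int)%type.

(* The monomial a^i z^j. *)
Definition az (i j : int) : laurent_az := << (1 : int) *g (i, j) >>.

(* p(a, z) |-> p(a0, z) in C[z, z^-1]; used for invertible a0. *)
Definition eval_a (F : fieldType) (a0 : F) (p : laurent_az) : grpalg F int :=
  \sum_(k <- msupp p) << (p@_k)%:~R * a0 ^ k.1 *g k.2 >>.

(* An oriented link diagram is put in general position with respect to the     *)
(* height function and cut by horizontal lines into slices, each containing    *)
(* one minimum, maximum or crossing.  Slices are listed from bottom to top.  A *)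
(* horizontal level is the word of the orientations of the strands met, from   *)
(* left to right: [true] for a strand going up, [false] for one going down.    *)
Notation word := (seq bool).

Inductive piece :=
| Cup of bool                    (* minimum; orientation of its left end *)
| Cap of bool                    (* maximum; orientation of its left end *)
(* [Cross b c e]: b and c are the orientations of the bottom left and bottom   *)
(* right ends; the strand from bottom left to top right is the over-strand iff *)
(* e = true.                                                                   *)
| Cross of bool & bool & bool.

Definition piece_code (x : piece) : (bool * bool) + (bool * bool * bool) :=
  match x with
  | Cup b => inl (true, b) | Cap b => inl (false, b)
  | Cross b c e => inr (b, c, e)
  end.
Definition piece_decode (x : (bool * bool) + (bool * bool * bool)) : piece :=
  match x with
  | inl (true, b) => Cup b | inl (false, b) => Cap b
  | inr (b, c, e) => Cross b c e
  end.
Lemma piece_codeK : cancel piece_code piece_decode. Proof. by case. Qed.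
HB.instance Definition _ := Countable.copy piece (can_type piece_codeK).

Definition pbot (x : piece) : word :=
  match x with
  | Cup _ => [::] | Cap b => [:: b; ~~ b] | Cross b c _ => [:: b; c]
  end.
Definition ptop (x : piece) : word :=
  match x with
  | Cup b => [:: b; ~~ b] | Cap _ => [::] | Cross b c _ => [:: c; b]
  end.

(* [(l, x, r)]: the piece x between vertical strands oriented by l and r. *)
Definition slice := (word * piece * word)%type.
Definition sbot (s : slice) : word := s.1.1 ++ pbot s.1.2 ++ s.2.
Definition stop (s : slice) : word := s.1.1 ++ ptop s.1.2 ++ s.2.

Fixpoint tangle (w : word) (t : seq slice) (w' : word) : bool :=
  if t is s :: t' then (w == sbot s) && tangle (stop s) t' w' else w == w'.

(* The empty link is excluded. *)
Record diagram := Diagram {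
  slices :> seq slice;
  slices_closed : (slices != [::]) && tangle [::] slices [::]
}.
HB.instance Definition _ := [isSub for slices].
HB.instance Definition _ := [Choice of diagram by <:].

Definition whisker (l : word) (t : seq slice) (r : word) : seq slice :=
  [seq (l ++ s.1.1, s.1.2, s.2 ++ r) | s <- t].

(* D and D' agree except in a box, where they are t and t' respectively. *)
Definition replace (t t' : seq slice) (D D' : diagram) : Prop :=
  exists pre post l r,
    slices D = pre ++ whisker l t r ++ post /\
    slices D' = pre ++ whisker l t' r ++ post.

(* Planar isotopy and the Reidemeister moves for diagrams with a height        *)
(* function (Turaev, Freyd-Yetter), for all orientations.                      *)
Inductive local_move : seq slice -> seq slice -> Prop :=
| move_height x m y : local_move
    [:: ([::], x, m ++ pbot y); (ptop x ++ m, y, [::])]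
    [:: (pbot x ++ m, y, [::]); ([::], x, m ++ ptop y)]
| move_zigzag_left b : local_move
    [:: ([:: b], Cup (~~ b), [::]); ([::], Cap b, [:: b])] [::]
| move_zigzag_right b : local_move
    [:: ([::], Cup b, [:: b]); ([:: b], Cap (~~ b), [::])] [::]
(* A strand c passing under (e = false) or over (e = true) an extremum. *)
| move_slide_cap b c e : local_move
    [:: ([:: b], Cross c (~~ b) e, [::]); ([::], Cap b, [:: c])]
    [:: ([::], Cross b c (~~ e), [:: ~~ b]); ([:: c], Cap b, [::])]
| move_slide_cup b c e : local_move
    [:: ([::], Cup b, [:: c]); ([:: b], Cross (~~ b) c (~~ e), [::])]
    [:: ([:: c], Cup b, [::]); ([::], Cross c b e, [:: ~~ b])]
| move_R1_cap b e : local_move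
    [:: ([::], Cross b (~~ b) e, [::]); ([::], Cap (~~ b), [::])]
    [:: ([::], Cap b, [::])]
| move_R1_cup b e : local_move
    [:: ([::], Cup b, [::]); ([::], Cross b (~~ b) e, [::])]
    [:: ([::], Cup (~~ b), [::])]
| move_R2 b c e : local_move
    [:: ([::], Cross b c e, [::]); ([::], Cross c b (~~ e), [::])] [::]
(* The condition on e12, e13, e23 says that "passes over" is acyclic on the    *)
(* three strands.                                                              *)
| move_R3 b1 b2 b3 e12 e13 e23 : e13 = e12 \/ e13 = e23 -> local_move
    [:: ([::], Cross b1 b2 e12, [:: b3]); ([:: b2], Cross b1 b3 e13, [::]);
        ([::], Cross b2 b3 e23, [:: b1])]
    [:: ([:: b1], Cross b2 b3 e23, [::]); ([::], Cross b1 b3 e13, [:: b2]);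
        ([:: b3], Cross b1 b2 e12, [::])].

Definition move (D D' : diagram) : Prop :=
  exists t t', local_move t t' /\ replace t t' D D'.

Definition isotopic (D D' : diagram) : bool :=
  `[< clos_refl_sym_trans diagram move D D' >].

Lemma isotopic_refl : reflexive isotopic.
Proof. by move=> D; apply/asboolP; exact: rst_refl. Qed.
Lemma isotopic_sym : symmetric isotopic.
Proof. by move=> D D'; apply/asboolP/asboolP; exact: rst_sym. Qed.
Lemma isotopic_trans : transitive isotopic.
Proof.
by move=> D' D D'' /asboolP DD' /asboolP D'D''; apply/asboolP;
  exact: rst_trans DD' D'D''.
Qed.
Canonical isotopic_equiv :=
  EquivRel isotopic isotopic_refl isotopic_sym isotopic_trans.

Definition link := {eq_quot isotopic_equiv}%qT.

Definition link_of (D : diagram) : link := \pi_link%qT D.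

Definition circle : diagram :=
  @Diagram [:: ([::], Cup true, [::]); ([::], Cap true, [::])] isT.

(* [Cross b c e] is a positive crossing iff e = (b == c): when both strands    *)
(* point upwards the crossing is positive iff the strand from bottom left to   *)
(* top right is above, and reversing one strand changes the sign.              *)
Definition crossing (positive : bool) (b c : bool) : seq slice :=
  [:: ([::], Cross b c ((b == c) == positive), [::])].

(* The smoothing consistent with the orientation is vertical if the two        *)
(* strands both go up or both go down, and horizontal otherwise.               *)
Definition smoothing (b c : bool) : seq slice :=
  if b == c then [::] else [:: ([::], Cap b, [::]); ([::], Cup c, [::])].

Definition skein_triple (Dp Dm D0 : diagram) : Prop :=
  exists pre post l r b c,
    [/\ slices Dp = pre ++ whisker l (crossing true b c) r ++ post,
        slices Dm = pre ++ whisker l (crossing false b c) r ++ post &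
        slices D0 = pre ++ whisker l (smoothing b c) r ++ post].

(* These properties determine P (Jones, Conway, HOMFLY, Przytycki-Traczyk).    *)
Definition jones_conway (P : link -> laurent_az) : Prop :=
  P (link_of circle) = 1 /\
  forall Dp Dm D0, skein_triple Dp Dm D0 ->
    az 1 0 * P (link_of Dp) + az (-1) 0 * P (link_of Dm) =
    az 0 1 * P (link_of D0).

(* n half twists of two vertical strands with bottom orientations b and c; all *)
(* the crossings would be positive if the strands were parallel.               *)
Fixpoint half_twists (n : nat) (b c : bool) : seq slice :=
  if n is n'.+1 then ([::], Cross b c true, [::]) :: half_twists n' c b
  else [::].

(* Any disk as in the move can be brought by a planar isotopy to a position    *)
(* where its two strands are vertical and adjacent.                            *)
Definition tbar_move (k : nat) (L L' : link) : Prop :=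
  exists D D' b,
    [/\ L = link_of D, L' = link_of D' &
        replace [::] (half_twists (2 * k) b (~~ b)) D D'].

(* Main.v *)
Require Import Defs.
From Stdlib Require Import Relation_Operators.
From mathcomp Require Import all_boot all_order all_algebra generic_quotient.
From mathcomp Require Import finmap monalg boolp.
From mathcomp Require Import reals complex.
From mathcomp Require Import ring.
Import GRing.Theory Num.Theory.
Local Open Scope ring_scope.

(** The twists of two antiparallel strands are negative crossings, so the skein
    relation can be applied to the lowest of [2 * j.+1] half twists.  Switching
    that crossing lets it cancel with the next one by a second Reidemeister
    move, which leaves [2 * j] half twists; smoothing it produces a cap below a
    cup, and the remaining half twists are curls of the cup, which come off by
    first Reidemeister moves.  The smoothed diagram is thus isotopic to one and
    the same diagram for every [j].  If x_j is the polynomial of the diagram with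
    [2 * j] half twists and y that of the untwisted smoothing, then
      a x_j + a^-1 x_(j+1) = z y,  that is,  x_(j+1) = - a^2 x_j + a z y.
    The affine map on the right has a fixed point as soon as 1 + a^2 is
    invertible, and its k-th iterate is then the identity if (- a^2)^k = 1.
    The first condition holds at [a0] because [a0] is not a square root of -1,
    the second one because of the equation satisfied by [a0].

    The recurrence is [skein_twist], its algebraic consequence
    [affine_rec_periodic]; [eval_aD] and [eval_a_az] carry the recurrence from
    the Laurent polynomials in a and z to those in z alone. *)

(** * Specialization of the variable a *)

Section Evaluation.
Context {F : fieldType} (a0 : F).
Implicit Types p q : laurent_az.

Lemma eval_aw {d : {fset int * int}} {p} : (msupp p `<=` d)%fset ->
  eval_a a0 p = \sum_(k <- d) << (p@_k)%:~R * a0 ^ k.1 *g k.2 >>.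
Proof.
move=> le_d; rewrite /eval_a; apply: big_fset_incl => // k _.
by move=> /mcoeff_outdom ->; rewrite mul0r monalgU0.
Qed.

Lemma eval_a0 : eval_a a0 0 = 0.
Proof. by rewrite /eval_a msupp0 big_seq_fset0. Qed.

Lemma eval_aD : {morph eval_a a0 : p q / p + q}.
Proof.
move=> p q; rewrite (eval_aw (msuppD_le p q)).
rewrite (eval_aw (fsubsetUl (msupp p) (msupp q))).
rewrite (eval_aw (fsubsetUr (msupp p) (msupp q))).
rewrite -big_split /=; apply: eq_bigr => k _.
by rewrite mcoeffD intrD mulrDl monalgUD.
Qed.

Lemma eval_aU c k :
  eval_a a0 << c *g k >> = << c%:~R * a0 ^ k.1 *g k.2 >>.
Proof. by rewrite (eval_aw msuppU_le) big_seq_fset1 mcoeffUU. Qed.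

Lemma eval_a_az i j p : a0 != 0 ->
  eval_a a0 (az i j * p) = (<< a0 ^ i *g j >> : grpalg F int) * eval_a a0 p.
Proof.
move=> a0_neq0.
have -> : az i j * p = \sum_(k <- msupp p) << 1 * p@_k *g (i, j) + k >>.
  exact: gamulUg.
rewrite (big_morph _ eval_aD eval_a0) /eval_a mulr_sumr.
apply: eq_bigr => k _; rewrite -/(eval_a _ _) eval_aU mul1r /=.
rewrite [RHS]gamulUU expfzDr //.
by congr (<< _ *g _ >>); ring.
Qed.

End Evaluation.

(** * Periodic affine recurrences *)

(** The sequence [(1 + a ^+ 2) * x j - a * c], which is [1 + a ^+ 2] times the
    distance to the fixed point, is geometric of ratio [- a ^+ 2]. *)
Lemma affine_rec_periodic {S : comNzRingType} (a a' u c : S) (k : nat)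
    (x : nat -> S) :
  a * a' = 1 -> u * (1 + a ^+ 2) = 1 -> (- a ^+ 2) ^+ k = 1 ->
  (forall j, a * x j + a' * x j.+1 = c) -> x k = x 0%N.
Proof.
move=> aa' u1 ak1 recx.
have geom j : (1 + a ^+ 2) * x j - a * c =
              (- a ^+ 2) ^+ j * ((1 + a ^+ 2) * x 0%N - a * c).
  elim: j => [|j IHj]; first by rewrite expr0 mul1r.
  have xS : x j.+1 = a * c - a ^+ 2 * x j.
    by rewrite -(recx j) mulrDr !mulrA aa'; ring.
  by rewrite (exprS (- a ^+ 2)) -mulrA -IHj xS; ring.
have := geom k; rewrite ak1 mul1r => /addIr/(congr1 ( *%R u)).
by rewrite !mulrA u1 !mul1r.
Qed.

(** * Tangles inside a box of a diagram *)

Lemma tangle_cat w v w' t1 t2 :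
  tangle w t1 v -> tangle v t2 w' -> tangle w (t1 ++ t2) w'.
Proof.
elim: t1 w => [|s t1 IH] w /=; first by move/eqP->.
by case/andP=> -> t1v t2w'; exact: IH.
Qed.

Lemma tangle_catP w w' t1 t2 :
  tangle w (t1 ++ t2) w' -> exists2 v, tangle w t1 v & tangle v t2 w'.
Proof.
elim: t1 w => [|s t1 IH] w /=; first by exists w.
by case/andP=> -> /IH.
Qed.

Lemma tangle_fun w w1 w2 t : tangle w t w1 -> tangle w t w2 -> w1 = w2.
Proof.
elim: t w => [|s t IH] w /=; first by move=> /eqP<- /eqP.
by move=> /andP[_ t1] /andP[_]; exact: IH.
Qed.

Lemma tangle_whisker l r w w' t :
  tangle w t w' -> tangle (l ++ w ++ r) (whisker l t r) (l ++ w' ++ r).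
Proof.
elim: t w => [|s t IH] w /=; first by move/eqP->.
case/andP=> /eqP-> /IH; rewrite /sbot /stop /= -!catA => ->.
by rewrite eqxx.
Qed.

Lemma whisker_cat l r t1 t2 :
  whisker l (t1 ++ t2) r = whisker l t1 r ++ whisker l t2 r.
Proof. exact: map_cat. Qed.

Lemma tangle_half_twists n b c :
  tangle [:: b; c] (half_twists n b c)
    (if odd n then [:: c; b] else [:: b; c]).
Proof.
elim: n b c => [|n IH] b c //=.
by rewrite eqxx /= if_neg; exact: IH.
Qed.

Lemma tangle_full_twists j b c :
  tangle [:: b; c] (half_twists (2 * j) b c) [:: b; c].
Proof. by have := tangle_half_twists (2 * j) b c; rewrite mul2n odd_double. Qed.

Lemma tangle_cup_twists n c :
  tangle [::] (([::], Cup c, [::]) :: half_twists n c (~~ c))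
    [:: c (+) odd n; ~~ (c (+) odd n)].
Proof.
have := tangle_half_twists n c (~~ c).
by rewrite /= -addbN; case: (odd n); rewrite ?addbT ?addbF ?negbK.
Qed.

(** [D0] splits as [pre] below [post] at a level that reads [l ++ w ++ r]; the
    box is inserted there, on the strands of [w]. *)
Section Box.
Context {D0 : diagram} {pre post : seq slice} {l w r : word}.
Hypothesis D0E : slices D0 = pre ++ post.
Hypothesis preP : tangle [::] pre (l ++ w ++ r).
Hypothesis postP : tangle (l ++ w ++ r) post [::].

(** Making this total in [t], with default [D0], keeps the proofs that the
    filled diagram is closed out of the statements about it. *)
Definition fill (t : seq slice) : diagram :=
  insubd D0 (pre ++ whisker l t r ++ post).

Lemma fillE t : tangle w t w ->
  slices (fill t) = pre ++ whisker l t r ++ post.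
Proof.
move=> tP; apply: insubdK; apply/andP; split; last first.
  by apply: tangle_cat preP _; apply: tangle_cat postP; exact: tangle_whisker.
(* The result is a non-empty link even for an empty [t], because [D0] is one. *)
have /andP[+ _] := slices_closed D0; rewrite D0E.
by case: (pre) => //=; case: (post) => // s p _; case: (whisker _ _ _).
Qed.

Lemma fill0 : fill [::] = D0.
Proof. by rewrite /fill /= -D0E; exact: valKd. Qed.

Lemma fill_move u t t' v : local_move t t' ->
  tangle w (u ++ t ++ v) w -> tangle w (u ++ t' ++ v) w ->
  link_of (fill (u ++ t ++ v)) = link_of (fill (u ++ t' ++ v)).
Proof.
move=> tt' tP t'P; apply/eqquotP/asboolP; apply: rst_step.
exists t, t'; split=> //.
exists (pre ++ whisker l u r), (whisker l v r ++ post), l, r.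
by rewrite !fillE // !whisker_cat -!catA.
Qed.

Lemma fill_skein b c v :
  tangle w (crossing true b c ++ v) w -> tangle w (smoothing b c ++ v) w ->
  skein_triple (fill (crossing true b c ++ v)) (fill (crossing false b c ++ v))
    (fill (smoothing b c ++ v)).
Proof.
move=> cP sP; exists pre, (whisker l v r ++ post), l, r, b, c.
by rewrite !fillE // !whisker_cat -!catA.
Qed.

(** Each half twist above a minimum is a curl, and removing it by a first
    Reidemeister move reverses the orientation of the minimum. *)
Lemma fill_uncurl u n c :
  tangle w u [::] -> w = [:: c (+) odd n; ~~ (c (+) odd n)] ->
  link_of (fill (u ++ ([::], Cup c, [::]) :: half_twists n c (~~ c))) =
  link_of (fill (u ++ [:: ([::], Cup (c (+) odd n), [::])])).
Proof.
move=> uP; elim: n c => [|n IH] c wE; first by rewrite addbF.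
rewrite /= addbN -addNb in wE *; rewrite -(IH (~~ c)) // negbK.
apply: (fill_move u _ _ (half_twists n (~~ c) c) (move_R1_cup c true));
  apply: tangle_cat uP _.
- by rewrite wE addNb -addbN; exact: (tangle_cup_twists n.+1 c).
- by have := tangle_cup_twists n (~~ c); rewrite negbK -wE.
Qed.

End Box.

Arguments fill : clear implicits.

(** * The recurrence *)

Section Twists.
Context {P : link -> laurent_az} (hP : jones_conway P).
Context {D0 : diagram} {pre post : seq slice} {l r : word} {b : bool}.
Let w : word := [:: b; ~~ b].
Hypothesis D0E : slices D0 = pre ++ post.
Hypothesis preP : tangle [::] pre (l ++ w ++ r).
Hypothesis postP : tangle (l ++ w ++ r) post [::].

Let box := fill D0 pre post l r.
Let twisted j := box (half_twists (2 * j) b (~~ b)).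
Let Doo := box [:: ([::], Cap b, [::]); ([::], Cup b, [::])].

(** The positive diagram of the skein relation at the lowest crossing is
    [twisted j], and the smoothed one does not depend on [j]. *)
Lemma skein_twist j :
  az 1 0 * P (link_of (twisted j)) + az (-1) 0 * P (link_of (twisted j.+1)) =
  az 0 1 * P (link_of Doo).
Proof.
pose v := half_twists (2 * j).+1 (~~ b) b.
have vP : tangle [:: ~~ b; b] v w.
  have := tangle_half_twists (2 * j).+1 (~~ b) b.
  by rewrite /= mul2n odd_double.
have twistedS : half_twists (2 * j.+1) b (~~ b) = crossing false b (~~ b) ++ v.
  have -> : (2 * j.+1)%N = (2 * j).+2 by rewrite !mul2n doubleS.
  by rewrite /v /crossing; case: (b).
have switched :
    link_of (box (crossing true b (~~ b) ++ v)) = link_of (twisted j).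
  have -> : crossing true b (~~ b) ++ v =
      [::] ++ [:: ([::], Cross b (~~ b) false, [::]);
                  ([::], Cross (~~ b) b true, [::])] ++
      half_twists (2 * j) b (~~ b).
    by rewrite /v /crossing /=; case: (b).
  apply: (fill_move D0E preP postP [::] _ _ _ (move_R2 b (~~ b) false)).
  - by rewrite /= !eqxx /=; exact: tangle_full_twists.
  - exact: tangle_full_twists.
have smoothed : link_of (box (smoothing b (~~ b) ++ v)) = link_of Doo.
  have := fill_uncurl D0E preP postP [:: ([::], Cap b, [::])]
    (2 * j).+1 (~~ b).
  rewrite !negbK /= mul2n odd_double addbT negbK => <- //;
    last by rewrite /w eqxx.
  by congr (link_of (box _)); rewrite /smoothing /v mul2n; case: (b).
rewrite [twisted j.+1]/twisted twistedS -smoothed -switched.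
apply: hP.2; apply: (fill_skein D0E preP postP).
- by rewrite /= eqxx.
- have /negPf bNb : b != ~~ b by case: (b).
  by apply: tangle_cat vP; rewrite /smoothing bNb /= /stop /= negbK !eqxx.
Qed.

End Twists.

(** * Invariance at a root of the twist equation *)

Theorem corollary0p3 (R : realType) (P : link -> laurent_az)
    (hP : jones_conway P) (k : nat) (hk : (1 <= k)%N) (a0 : R[i])
    (ha0 : a0 ^+ (2 * k) = (-1) ^+ k) (ha0i : a0 != 'i) (ha0Ni : a0 != - 'i)
    (L L' : link) (hL : tbar_move k L L') :
  eval_a a0 (P L') = eval_a a0 (P L).
Proof.
case: hL => D [D' [b [-> -> [pre [post [l [r [DE D'E]]]]]]]].
have /andP[_] := slices_closed D'; rewrite D'E.
case/tangle_catP=> w preP /tangle_catP[w' tP postP].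
(* The twisted box is non-empty since [k] is positive, so its first slice shows
   the level at which it was inserted. *)
have wE : w = l ++ [:: b; ~~ b] ++ r.
  case: (k) hk tP => // k' _.
  have -> : (2 * k'.+1)%N = (2 * k').+2 by rewrite !mul2n doubleS.
  by case/andP=> /eqP-> _; rewrite /sbot /= cats0.
have w'E : w' = w.
  have := tangle_whisker l r _ _ _ (tangle_full_twists k b (~~ b)).
  by rewrite -wE; exact: tangle_fun tP.
move: preP postP; rewrite w'E wE => preP postP.
have D0E : D = pre ++ post :> seq slice by [].
have DkE : D' = fill D pre post l r (half_twists (2 * k) b (~~ b)).
  apply: val_inj; rewrite /= D'E (fillE D0E preP postP) //.
  exact: tangle_full_twists.
have a0_neq0 : a0 != 0.
  apply/eqP=> a00; move/eqP: ha0.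
  by rewrite a00 expr0n muln_eq0 /= -leqn0 leqNgt hk eq_sym signr_eq0.
have a0_unit : 1 + a0 ^+ 2 != 0.
  by rewrite addrC -[1]opprK -sqrCi subr_sqr mulf_neq0 // ?subr_eq0 ?addr_eq0.
(* The coefficients of the recurrence are constants in z. *)
pose C (c : R[i]) : grpalg R[i] int := << c *g 0 >>.
have CM c d : C c * C d = C (c * d) by rewrite [LHS]gamulUU addr0.
have CX c n : C c ^+ n = C (c ^+ n).
  by elim: n => [//|n IHn]; rewrite !exprS IHn CM.
have CD c d : C c + C d = C (c + d) by rewrite /C monalgUD.
have C1 : 1 = C 1 by [].
have CN c : - C c = C (- c) by rewrite /C monalgUN.
pose x j := eval_a a0 (P (link_of
  (fill D pre post l r (half_twists (2 * j) b (~~ b))))).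
have -> : eval_a a0 (P (link_of D)) = x 0%N by rewrite /x muln0 fill0.
rewrite DkE -/(x k).
apply: (affine_rec_periodic (C a0) (C a0^-1) (C (1 + a0 ^+ 2)^-1)).
- by rewrite CM mulfV.
- by rewrite CX C1 CD CM mulVf.
- by rewrite CX CN CX C1 exprNn -exprM ha0 -exprMn mulrNN mulr1 expr1n.
move=> j; have := skein_twist hP D0E preP postP j.
move=> /(congr1 (eval_a a0)); rewrite eval_aD !eval_a_az //.
exact.
Qed.
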